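(* Let $p\ge1$, let $E$ be a separable metrisable space that is a star convex set in a linear space with center $x_0\in E$, and let $d$ be a complete metric inducing the topology of $E$ such that $$d((1-\lambda)x_0+\lambda x,y)\le(1-\lambda)d(x_0,y)+\lambda d(x,y)\quad\text{for all }\lambda\in[0,1]\text{ and }x,y\in E.$$ Let $(I,\mathcal{I})$ be a non-empty measurable space and $(\Omega,\mathcal{F},\mathbb{P})$ a probability space. Then for any product measurable $p$-fold integrable process $X:I\times\Omega\to E$ the distribution map $$I\to\mathcal{P}_p(E),\quad t\mapsto\mathcal{L}(X_t)$$ is Borel measurable.
   Context: $\mathcal{P}_p(E)$ is the set of all Borel probability measures $\mu$ on $E$ with $\int_Ed(x,y_0)^p\,\mu(\mathrm{d}x)<\infty$ for some $y_0\in E$, endowed with the $p$th Wasserstein metric $\mathcal{W}_p(\mu,\nu):=\inf_\theta(\int_{E\times E}d(x,y)^p\,\mathrm{d}\theta(x,y))^{1/p}$, where the infimum runs over all Borel probability measures $\theta$ on $E\times E$ with first and second marginals $\mu$ and $\nu$. ''$p$-fold integrable'' means that for each $t\in I$, $\mathbb{E}[d(X_t,y_0)^p]<\infty$ for some $y_0\in E$. $\mathcal{L}(X_t)$ is the law of $X_t$. Product measurable means measurable with respect to $\mathcal{I}\otimes\mathcal{F}$ and $\mathcal{B}(E)$; Borel measurability of the distribution map means measurability with respect to $\mathcal{I}$ and the Borel $\sigma$-field of $(\mathcal{P}_p(E),\mathcal{W}_p)$. *)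

(* Defs.v *)
From HB Require Import structures.
From mathcomp Require Import all_boot all_order all_algebra.
From mathcomp Require Import all_classical all_reals all_analysis measurable_realfun.

Set Implicit Arguments.
Unset Strict Implicit.
Unset Printing Implicit Defensive.

Import Order.TTheory GRing.Theory Num.Theory.
Import numFieldNormedType.Exports.

Local Open Scope classical_set_scope.
Local Open Scope ring_scope.

(* [Complete] comes with a distinguished point, which measurable types need;
   it is arbitrary and only expresses that the space is non-empty. *)
#[short(type="completeMetricType")]
HB.structure Definition CompleteMetric (R : numDomainType) :=
  {T of Metric R T & Complete T}.

Definition separable (T : topologicalType) : Prop :=
  exists2 D : set T, countable D & dense D.

(* The linear space L need not carry a topology: the topology of E is the one
   of its metric, and E is viewed as the subset [range i] of L through an
   injection i. *)
Definition star_convex_embedding (R : realType) (L : lmodType R) (E : Type)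
    (i : E -> L) (x0 : E) : Prop :=
  injective i /\
  forall (l : R) (x : E), 0 <= l <= 1 ->
    range i ((1 - l) *: i x0 + l *: i x).

Notation borel T := (g_sigma_algebraType (@open T)).

Section wasserstein.
Context {R : realType} {E : completeMetricType R}.
Implicit Types (p : R) (mu nu : probability (borel E) R).

Definition finite_moment p mu : Prop :=
  exists y0 : E, (\int[mu]_x (mdist (x : E) y0 `^ p)%:E < +oo)%E.

Definition coupling mu nu : set (probability (borel (E * E)%type) R) :=
  [set theta | forall A : set (borel E), measurable A ->
     theta (fst @^-1` A) = mu A /\ theta (snd @^-1` A) = nu A].

Definition wasserstein_dist p mu nu : \bar R :=
  ereal_inf [set ((\int[theta]_z (mdist z.1 z.2 `^ p)%:E) `^ p^-1)%E
            | theta in coupling mu nu].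

(* Probabilities are functions on all sets, so two points of this type that
   agree on Borel sets represent the same measure; they are at distance 0,
   hence not separated by the sets in [wasserstein_open]. *)
Record wasserstein_space (p : R) := WassersteinSpace {
  wmeasure :> probability (borel E) R ;
  wmeasure_finite_moment : finite_moment p wmeasure }.

Definition wasserstein_open p : set (set (wasserstein_space p)) :=
  [set U | forall mu : wasserstein_space p, U mu -> exists2 e : R, 0 < e &
     forall nu : wasserstein_space p,
       (wasserstein_dist p mu nu < e%:E)%E -> U nu].

Lemma measurable_mdist_powR p (y0 : E) :
  measurable_fun [set: borel E]
    ((fun x => (mdist x y0 `^ p)%:E) : borel E -> \bar R).
Proof.
have mdy : measurable_fun [set: borel E] ((fun x => mdist x y0) : borel E -> R).
  apply: (measurability _ (RGenInftyO.measurableE R)) => //.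
  move=> _ [_ [s ->] <-]; apply: sub_sigma_algebra; rewrite setTI.
  rewrite openE => x /=; rewrite in_itv/= => xs.
  rewrite /interior; apply/nbhs_ballP; exists (s - mdist x y0) => /=.
    by rewrite subr_gt0.
  move=> z; rewrite ballEmdist/= in_itv/= metric_sym => zx.
  by rewrite (le_lt_trans (metric_triangle z x y0))// -ltrBrDr.
by apply/measurable_EFinP; exact: measurableT_comp (measurable_powR p) mdy.
Qed.

Lemma dirac_finite_moment p (x : E) :
  finite_moment p (dirac (x : borel E) : probability (borel E) R).
Proof.
exists x; rewrite integral_dirac//; last exact: measurable_mdist_powR.
by rewrite diracT mul1e ltry.
Qed.

HB.instance Definition _ p := gen_eqMixin (wasserstein_space p).
HB.instance Definition _ p := gen_choiceMixin (wasserstein_space p).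
HB.instance Definition _ p := isPointed.Build (wasserstein_space p)
  (WassersteinSpace (dirac_finite_moment p point)).

End wasserstein.
Arguments wasserstein_space {R} E p.
Arguments wasserstein_open {R} E p.

Notation borel_wasserstein E p := (g_sigma_algebraType (wasserstein_open E p)).

Section process.
Context {dI dO} {I : measurableType dI} {Omega : measurableType dO}.
Context {R : realType} {E : completeMetricType R}.
Variables (P : probability Omega R) (p : R).
Variable X : {mfun (I * Omega)%type >-> borel E}.

Definition process_at (t : I) : Omega -> borel E := fun w => X (t, w).

Lemma measurable_process_at t : measurable_fun [set: Omega] (process_at t).
Proof. exact: (measurableT_comp (measurable_funPT X) (pair1_measurable t)). Qed.

HB.instance Definition _ t :=
  isMeasurableFun.Build _ _ _ _ (process_at t) (measurable_process_at t).

Definition integrable_process : Prop := forall t, exists y0 : E,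
  (\int[P]_w (mdist (process_at t w : E) y0 `^ p)%:E < +oo)%E.

Definition law (t : I) : probability (borel E) R :=
  distribution P (process_at t).

Lemma law_finite_moment (iX : integrable_process) t : finite_moment p (law t).
Proof.
have [y0 iy0] := iX t; exists y0.
rewrite (@ge0_integral_distribution _ _ _ _ _ P (process_at t)
  (fun x => (mdist (x : E) y0 `^ p)%:E))//.
- exact: measurable_mdist_powR.
- by move=> y; rewrite lee_fin powR_ge0.
Qed.

Definition distribution_map (iX : integrable_process) (t : I) :
    borel_wasserstein E p :=
  WassersteinSpace (law_finite_moment iX t).

End process.

(* Main.v *)
(* Fix a dense sequence a and let c be the image of the law mu_t of X_t under
   the map sending x to a closest point among a 0, ..., a n, with its weights
   lowered slightly to rationals and the missing mass moved to a 0.  By dominated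
   convergence such c approximate mu_t, with an error bounded by an integral that
   is measurable in t, so the preimage of an open set is the countable union,
   over those discrete measures c which have a ball contained in the open set, of
   the measurable sets of t for which the error bound is below the radius of that
   ball.  The triangle inequality is needed only through such a discrete c.  The
   coupling of mu_t and c has a density with respect to mu_t x c, so it is glued
   to a coupling theta of c and nu by means of a density with respect to
   mu_t x theta, without disintegration.  A quasi-triangle inequality, with
   (x + y)^p <= 2^p (x^p + y^p) in place of Minkowski, suffices. *)

From HB Require Import structures.
Require Import Defs.
From mathcomp Require Import all_boot all_order all_algebra.
From mathcomp Require Import all_classical all_reals all_analysis measurable_realfun.
From mathcomp Require Import ring lra.

Set Implicit Arguments.
Unset Strict Implicit.
Unset Printing Implicit Defensive.

Import Order.TTheory GRing.Theory Num.Theory.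
Import numFieldNormedType.Exports.

Local Open Scope classical_set_scope.
Local Open Scope ring_scope.

(** * Measures given by a density *)

Section density.
Local Open Scope ereal_scope.
Context d (T : measurableType d) (R : realType).
Variables (mu : {measure set T -> \bar R}) (h : T -> R).
Hypotheses (mh : measurable_fun setT h) (h0 : forall x, (0 <= h x)%R).

(** The two proofs are arguments so that the measure structure below can be attached to the term
    [mdensity mh h0]. *)
Definition mdensity of measurable_fun setT h & (forall x, (0 <= h x)%R) :=
  fun A : set T => \int[mu]_(x in A) (h x)%:E.

Local Notation nu := (mdensity mh h0).

Let mdensity0 : nu set0 = 0. Proof. exact: integral_set0. Qed.

Let mdensity_ge0 A : 0 <= nu A.
Proof. by apply: integral_ge0 => x _; rewrite lee_fin. Qed.

Let mdensity_sigma_additive : semi_sigma_additive nu.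
Proof.
move=> F mF tF mUF; rewrite /mdensity ge0_integral_bigcup//.
- apply: is_cvg_nneseries => n _ _.
  by apply: integral_ge0 => x _; rewrite lee_fin.
- by apply/measurable_EFinP; exact: measurable_funTS.
- by move=> x _; rewrite lee_fin.
Qed.

HB.instance Definition _ := isMeasure.Build d T R nu
  mdensity0 mdensity_ge0 mdensity_sigma_additive.

Import HBNNSimple.

Let integral_mdensity_indic A : measurable A ->
  \int[nu]_x (\1_A x)%:E = \int[mu]_x ((\1_A x)%:E * (h x)%:E).
Proof.
move=> mA; rewrite integral_indic// setIT [LHS]/= [LHS]integral_mkcond.
by apply: eq_integral => x _; rewrite patchE indicE; case: ifPn;
  rewrite ?mul1e ?mul0e.
Qed.

(** Both sides are monotone limits along simple functions increasing to [f]; for these, linearity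
    reduces the claim to indicators. *)
Lemma ge0_integral_mdensity (f : T -> \bar R) :
  measurable_fun setT f -> (forall x, 0 <= f x) ->
  \int[nu]_x f x = \int[mu]_x (f x * (h x)%:E).
Proof.
move=> mf f0; pose g := nnsfun_approx measurableT mf.
have gf x : (EFin \o g^~ x) @ \oo --> f x.
  by apply: cvg_nnsfun_approx => // ? _; exact: f0.
have gnd x : nondecreasing_seq (fun n => (g n x)%:E).
  by move=> m n mn; rewrite lee_fin; exact/lefP/nd_nnsfun_approx.
have mg n : measurable_fun setT (fun x => (g n x)%:E) by exact/measurable_EFinP.
transitivity (limn (fun n => \int[nu]_x (g n x)%:E)).
  rewrite -monotone_convergence//.
  - by apply: eq_integral => x _; apply/esym/cvg_lim => //; exact: gf.
  - by move=> n x _; rewrite lee_fin.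
transitivity (limn (fun n => \int[mu]_x ((g n x)%:E * (h x)%:E))); last first.
  rewrite -monotone_convergence//.
  - apply: eq_integral => x _; apply/cvg_lim => //.
    by apply: cvgeZr => //; exact: gf.
  - by move=> n; apply: emeasurable_funM => //; exact/measurable_EFinP.
  - by move=> n x _; rewrite mule_ge0 ?lee_fin.
  - by move=> x _ m n mn; rewrite lee_wpmul2r ?lee_fin// -lee_fin; exact: gnd.
congr (limn _); apply/funext => n.
have mi r : measurable_fun setT
    (fun x => (r * \1_(g n @^-1` [set r]) x)%:E).
  by apply/measurable_EFinP; exact: measurable_funM.
under [LHS]eq_integral do rewrite fimfunE -fsumEFin//.
rewrite ge0_integral_fsum//; last by move=> r x _; exact: nnfun_muleindic_ge0.
transitivity (\int[mu]_x (\sum_(r \in range (g n))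
    ((r * \1_(g n @^-1` [set r]) x)%:E * (h x)%:E))); last first.
  apply: eq_integral => x _.
  rewrite -ge0_mule_fsuml => [|y]; last exact: nnfun_muleindic_ge0.
  by rewrite fsumEFin// -fimfunE.
rewrite ge0_integral_fsum//; last 2 first.
- by move=> r; apply: emeasurable_funM => //; exact/measurable_EFinP.
- by move=> r x _; rewrite mule_ge0 ?lee_fin// -lee_fin nnfun_muleindic_ge0.
apply: eq_fsbigr => r /[!inE] -[t _ gt].
have r0 : (0 <= r)%R by rewrite -gt.
under [LHS]eq_integral do rewrite EFinM.
under [RHS]eq_integral do rewrite EFinM -muleA.
rewrite !ge0_integralZl//= ?lee_fin//.
- by rewrite integral_mdensity_indic.
- apply: emeasurable_funM; last exact/measurable_EFinP.
  by apply/measurable_EFinP; exact: measurable_indic.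
- by move=> x _; rewrite mule_ge0 ?lee_fin.
- by apply/measurable_EFinP; exact: measurable_indic.
Qed.

End density.

Lemma measurable_g_sigma_algebra (S T : pointedType) (G : set (set S))
    (H : set (set T)) (f : S -> T) : (forall A, H A -> G (f @^-1` A)) ->
  measurable_fun [set: g_sigma_algebraType G]
    (f : g_sigma_algebraType G -> g_sigma_algebraType H).
Proof.
move=> GH; apply: (@measurability _ _ (g_sigma_algebraType G)
  (g_sigma_algebraType H) _ _ H) => //.
by move=> _ [A HA <-]; rewrite setTI; apply: sub_sigma_algebra; exact: GH.
Qed.

(** * Borel sets of a separable metric space and of its square *)

Section borel_metric.
Context {R : realType} {E : completeMetricType R}.

Lemma measurable_mdist_prod :
  measurable_fun [set: borel (E * E)%type] (fun z => mdist z.1 z.2 : R).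
Proof.
apply: (measurability _ (RGenInftyO.measurableE R)) => //.
move=> _ [_ [s ->] <-]; apply: sub_sigma_algebra; rewrite setTI.
rewrite openE => -[x y] /=; rewrite in_itv/= => xys.
(* Moving each coordinate by less than half of the gap [s - mdist x y] keeps the distance below
   [s]. *)
pose e := (s - mdist x y) / 2.
have e0 : 0 < e by rewrite divr_gt0// subr_gt0.
exists (ball x e, ball y e) => /=.
  by split; exact: nbhsx_ballx.
move=> -[u v] /= []; rewrite !ballEmdist/= in_itv/= => xu yv.
have : mdist u v <= mdist x u + mdist x y + mdist y v.
  rewrite (metric_sym x u) -addrA.
  by rewrite (le_trans (metric_triangle u x v))// lerD2l metric_triangle.
by move=> /le_lt_trans; apply; rewrite /e in xu yv; lra.
Qed.

Lemma measurable_mdist (y : E) :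
  measurable_fun [set: borel E] (fun x => mdist (x : E) y : R).
Proof.
have -> : (fun x : borel E => mdist (x : E) y : R) =
    (fun z : borel (E * E)%type => mdist z.1 z.2 : R) \o (fun x : E => (x, y)).
  by [].
apply: (measurableT_comp measurable_mdist_prod).
apply: measurable_g_sigma_algebra; apply/continuousP => x.
by apply: cvg_pair => //; exact: cvg_cst.
Qed.

Lemma borel_measurable_set1 (y : E) : measurable ([set y] : set (borel E)).
Proof.
have -> : [set y] = [set: borel E] `&`
    (fun x => mdist (x : E) y : R) @^-1` [set 0].
  apply/seteqP; split => [x ->|x [_ /=]]; first by split => //=; rewrite mdistxx.
  exact: mdist_positivity.
exact: measurable_mdist.
Qed.

Definition dense_seq (a : nat -> E) :=
  forall (x : E) (e : R), 0 < e -> exists k, mdist x (a k) < e.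

Lemma separable_dense_seq : separable E -> exists a, dense_seq a.
Proof.
move=> [D cD dD]; have [D0|] := pfcard_geP cD.
  (* An empty [D] would not meet the whole space, which contains [point]. *)
  have [x []] := dD setT (ex_intro _ point Logic.I) openT.
  by rewrite D0.
move=> [f]; exists f => x e e0.
have := dD (interior (ball x e)) _ (open_interior _); case.
  by exists x; exact: nbhsx_ballx.
move=> y [/interior_subset + Dy]; rewrite ballEmdist/=.
by have [k _ <-] := 'surj_f Dy; exists k.
Qed.

(** By separability every open set of the square is a countable union of products of balls with
    centers in a dense sequence and radii [m.+1%:R^-1]. *)
Lemma measurable_borel_prod : separable E ->
  measurable_fun [set: (borel E * borel E)%type]
    (id : borel E * borel E -> borel (E * E)%type).
Proof.
move=> /separable_dense_seq[a da].
apply: (@measurability _ _ _ (borel (E * E)%type) _ _ (@open (E * E)%type)) => //.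
move=> _ [A oA <-]; rewrite setTI.
pose B k m : set (borel E) := [set x : borel E | mdist (x : E) (a k) < m.+1%:R^-1].
have mB k m : measurable (B k m).
  rewrite (_ : B k m = [set: borel E] `&`
      (fun x => mdist (x : E) (a k) : R) @^-1` `]-oo, m.+1%:R^-1[%classic).
    exact: measurable_mdist.
  by rewrite setTI; apply/seteqP; split => x; rewrite /B/= in_itv.
(* A product that leaves [A] is replaced by the empty set, so the union runs over all triples of
   naturals. *)
pose F (t : nat * nat * nat) : set (borel E * borel E) :=
  if `[< B t.1.1 t.2 `*` B t.1.2 t.2 `<=` A >] then
    B t.1.1 t.2 `*` B t.1.2 t.2 else set0.
rewrite (_ : _ @^-1` A = \bigcup_t F t).
  apply: countable_bigcupT_measurable => // t; rewrite /F; case: ifPn => _ //.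
  exact: measurableX.
apply/seteqP; split => [[x y] Axy|z [t _]]; last first.
  by rewrite /F; case: asboolP => // + Bz; exact.
have /nbhs_ballP[/= e e0 exy] : nbhs ((x, y) : E * E) A by exact: open_nbhs_nbhs.
(* Two points of a ball of this radius are at distance below [e]. *)
have [m me] : exists m, m.+1%:R^-1 < e / 2 :> R.
  have e20 : 0 < e / 2 by rewrite divr_gt0.
  exists (Num.truncn (e / 2)^-1).
  by rewrite -[ltRHS]invrK ltf_pV2 ?posrE ?invr_gt0// truncnS_gt.
have m0 : 0 < m.+1%:R^-1 :> R by rewrite invr_gt0.
have [i xi] := da x _ m0; have [j yj] := da y _ m0.
exists (i, j, m) => //; rewrite /F; case: asboolP => [_|]//.
case=> -[u v] /= [Bu Bv]; apply: exy; split => /=; rewrite ballEmdist/=.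
  rewrite (le_lt_trans (metric_triangle x (a i) u))//.
  by rewrite (splitr e) ltrD// (lt_trans _ me)// metric_sym.
rewrite (le_lt_trans (metric_triangle y (a j) v))//.
by rewrite (splitr e) ltrD// (lt_trans _ me)// metric_sym.
Qed.

End borel_metric.

(** * Measures of mass one, integrals against discrete measures, powers of sums *)

Section measure_probability.
Context d (T : measurableType d) (R : realType).
Variables (m : {measure set T -> \bar R}) (m1 : m setT = 1%E).

Definition mprob of m setT = 1%E : set T -> \bar R := m.

HB.instance Definition _ := Measure.copy (mprob m1) m.
HB.instance Definition _ := Measure_isProbability.Build d T R (mprob m1) m1.

End measure_probability.

(** An integral only sees the values of [c] on measurable sets, where [c] agrees with a sum of
    scaled Dirac measures. *)
Lemma ge0_integral_sum_dirac d (T : measurableType d) (R : realType)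
    (c : {measure set T -> \bar R}) n (w : nat -> R) (b : nat -> T)
    (f : T -> \bar R) :
  (forall k, 0 <= w k) ->
  (forall A, measurable A -> c A = \sum_(k < n) (w k)%:E * \d_(b k) A)%E ->
  measurable_fun setT f -> (forall x, 0 <= f x)%E ->
  (\int[c]_x f x = \sum_(k < n) (w k)%:E * f (b k))%E.
Proof.
move=> w0 cE mf f0; pose w' k : {nonneg R} := NngNum (w0 k).
rewrite (eq_measure_integral (msum (fun k => mscale (w' k) \d_(b k)) n)).
  rewrite ge0_integral_measure_sum//; apply: eq_bigr => k _.
  by rewrite ge0_integral_mscale// integral_dirac// diracT mul1e.
by move=> A mA _; rewrite cE.
Qed.

(** The sum is at most twice the larger of the two terms. *)
Lemma ler_powRD (R : realType) (p x y : R) : 0 <= p -> 0 <= x -> 0 <= y ->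
  (x + y) `^ p <= 2 `^ p * (x `^ p + y `^ p).
Proof.
move=> p0 x0 y0; wlog xy : x y x0 y0 / x <= y => [th|].
  have [xy|/ltW yx] := leP x y; first exact: th.
  by rewrite addrC (addrC (x `^ p)); exact: th.
apply: (@le_trans _ _ ((2 * y) `^ p)).
  by rewrite ge0_ler_powR ?nnegrE ?addr_ge0 ?mulr_ge0// mulr_natl mulr2n lerD2r.
by rewrite powRM// ler_wpM2l ?powR_ge0// lerDr powR_ge0.
Qed.

(** * Gluing couplings along a discrete measure *)

Section glue.
Context {R : realType} {E : completeMetricType R}.
Hypothesis sE : separable E.
Variables (mu c nu : probability (borel E) R).
Variable theta : probability (borel (E * E)%type) R.
Hypothesis ctheta : coupling c nu theta.
Variables (n : nat) (b : nat -> E) (w : nat -> R) (h : nat -> borel E -> R).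
Hypothesis w0 : forall k, 0 <= w k.
Hypothesis cE : forall A : set (borel E), measurable A ->
  (c A = \sum_(k < n) (w k)%:E * \d_(b k : borel E) A)%E.
Hypothesis mh : forall k, measurable_fun [set: borel E] (h k).
Hypothesis h0 : forall k x, 0 <= h k x.
Hypothesis h1 : forall x, \sum_(k < n) h k x = 1.
Hypothesis hw : forall k, (\int[mu]_x (h k x)%:E = (w k)%:E)%E.

(** The [c]-mass of the point [y]; weights are added because the points [b j] may coincide. *)
Let atom (y : E) : R := \sum_(j < n) w j * (b j == y)%:R.

(* The density with respect to [mu \x c] of the coupling of [mu] and [c] that
   moves the part [h k * mu] of [mu] to the point [b k]. *)
Let H (x y : borel E) : R := \sum_(k < n) (y == b k)%:R * (h k x / atom (b k)).

Let atom_ge0 y : 0 <= atom y.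
Proof. by apply: sumr_ge0 => j _; rewrite mulr_ge0. Qed.

Let H_ge0 x y : 0 <= H x y.
Proof. by apply: sumr_ge0 => k _; rewrite mulr_ge0// divr_ge0. Qed.

Let measurable_eq_point (y : E) :
  measurable_fun [set: borel E] (fun x : borel E => (x == y)%:R : R).
Proof.
have -> : (fun x : borel E => (x == y)%:R : R) = \1_[set (y : borel E)].
  by apply/funext => x; rewrite indicE; congr (_ _)%:R; apply/eqP/idP; rewrite inE.
by apply: measurable_indic; exact: borel_measurable_set1.
Qed.

Let measurable_borel_fst : measurable_fun [set: borel (E * E)%type]
  (fst : borel (E * E)%type -> borel E).
Proof.
apply: measurable_g_sigma_algebra; apply/continuousP => z; exact: cvg_fst.
Qed.

Let measurable_borel_snd : measurable_fun [set: borel (E * E)%type]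
  (snd : borel (E * E)%type -> borel E).
Proof.
apply: measurable_g_sigma_algebra; apply/continuousP => z; exact: cvg_snd.
Qed.

(** The density [H] read on triples: [t] stands for [(x, (y, z))] with [x] from [mu] and [(y, z)]
    from [theta]. *)
Let H' (t : borel E * borel (E * E)%type) : R := H t.1 t.2.1.

Let measurable_H' : measurable_fun setT H'.
Proof.
apply: measurable_sum => k; apply: measurable_funM.
  apply: (measurableT_comp (measurable_eq_point (b k))).
  by apply: (measurableT_comp measurable_borel_fst); exact: measurable_snd.
by apply: measurable_funM => //; apply: (measurableT_comp (mh k)).
Qed.

Let H'_ge0 t : 0 <= H' t. Proof. exact: H_ge0. Qed.

Let psi (t : borel E * borel (E * E)%type) : borel (E * E)%type :=
  (t.1, t.2.2).

Let measurable_psi : measurable_fun setT psi.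
Proof.
apply: (measurableT_comp (measurable_borel_prod sE)).
apply: measurable_fun_pair => //.
by apply: (measurableT_comp measurable_borel_snd); exact: measurable_snd.
Qed.

(** The glued coupling: the law of [(x, z)] after [mu \x theta] is reweighted by [H']. *)
Let rho : {measure set (borel (E * E)%type) -> \bar R}.
Proof.
unshelve refine (pushforward (mdensity (mu \x theta)%E measurable_H' H'_ge0) psi
  : {measure set _ -> \bar R}).
exact: measurable_psi.
Defined.

Let integral_rho (f : borel (E * E)%type -> \bar R) : measurable_fun setT f ->
  (forall z, 0 <= f z)%E ->
  (\int[rho]_z f z = \int[mu \x theta]_t (f (psi t) * (H' t)%:E))%E.
Proof.
move=> mf f0; rewrite (ge0_integral_pushforward measurable_psi)//.
rewrite preimage_setT ge0_integral_mdensity//.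
by apply: (measurableT_comp mf); exact: measurable_psi.
by move=> t; exact: f0.
Qed.

Let integral_theta_fst (f : borel E -> \bar R) : measurable_fun setT f ->
  (forall x, 0 <= f x)%E ->
  (\int[theta]_z f z.1 = \sum_(k < n) (w k)%:E * f (b k))%E.
Proof.
move=> mf f0; rewrite -(ge0_integral_sum_dirac w0 cE)//.
have := ge0_integral_pushforward measurable_borel_fst theta measurableT mf.
rewrite preimage_setT => <-; last by move=> x _; exact: f0.
by apply: eq_measure_integral => A mA _; exact: (ctheta mA).1.
Qed.

(** Integrating out [(y, z)] first turns the inner integral into a sum over the atoms of [c], where
    the mass of each atom cancels against the denominator in [H]. Only an inequality results,
    because points of mass zero contribute nothing. *)
Let integral_H_le (f : borel E -> borel E -> R) :
  measurable_fun [set: borel E * borel E] (fun t => f t.1 t.2) ->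
  (forall x y, 0 <= f x y) ->
  (\int[mu \x theta]_t ((f t.1 t.2.1)%:E * (H' t)%:E) <=
   \int[mu]_x (\sum_(k < n) h k x * f x (b k))%:E)%E.
Proof.
move=> mf f0.
have mfp : measurable_fun [set: borel E * borel (E * E)%type]
    (fun t => f t.1 t.2.1).
  have mg : measurable_fun [set: borel E * borel (E * E)%type]
      (fun t => (t.1, t.2.1) : borel E * borel E).
    apply: measurable_fun_pair => //.
    by apply: (measurableT_comp measurable_borel_fst); exact: measurable_snd.
  exact: (measurableT_comp mf mg).
have mfH : measurable_fun [set: borel E * borel (E * E)%type]
    (fun t => (f t.1 t.2.1)%:E * (H' t)%:E)%E.
  by apply: emeasurable_funM; exact/measurable_EFinP.
have mfr k : measurable_fun setT (fun x => f x (b k)).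
  have mg : measurable_fun [set: borel E]
      (fun x => (x, b k) : borel E * borel E) by exact: measurable_fun_pair.
  exact: (measurableT_comp mf mg).
rewrite fubini_tonelli1//; last by move=> t; rewrite mule_ge0 ?lee_fin.
apply: ge0_le_integral => //.
- by move=> x _; apply: integral_ge0 => z _; rewrite mule_ge0 ?lee_fin.
- by apply: measurable_fun_fubini_tonelli_F => // t; rewrite mule_ge0 ?lee_fin.
- apply/measurable_EFinP; apply: measurable_sum => k.
  exact: measurable_funM.
move=> x _; rewrite /fubini_F/=.
rewrite (integral_theta_fst (f := fun y => ((f x y)%:E * (H x y)%:E)%E)); last 2 first.
- have mfx : measurable_fun setT (f x).
    have mg : measurable_fun [set: borel E]
        (fun y => (x, y) : borel E * borel E) by exact: measurable_fun_pair.
    exact: (measurableT_comp mf mg).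
  apply: emeasurable_funM; first exact/measurable_EFinP.
  apply/measurable_EFinP; apply: measurable_sum => k.
  exact: measurable_funM.
- by move=> y; rewrite mule_ge0 ?lee_fin.
rewrite (eq_bigr (fun j : 'I_n => (\sum_(k < n) w j * f x (b j) *
    ((b j == b k)%:R * (h k x / atom (b k))))%:E)); last first.
  by move=> j _; rewrite -!EFinM mulrA /H mulr_sumr.
rewrite sumEFin lee_fin.
rewrite exchange_big/=; apply: ler_sum => k _.
have -> : \sum_(j < n) w j * f x (b j) *
    ((b j == b k)%:R * (h k x / atom (b k))) =
    h k x * f x (b k) * (atom (b k) / atom (b k)).
  rewrite /atom mulr_suml mulr_sumr; apply: eq_bigr => j _.
  by have [->|] := eqVneq (b j) (b k); rewrite ?mul0r ?mulr0 ?mul0r ?mulr0//; ring.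
rewrite ler_piMr ?mulr_ge0//.
(* Division by zero yields 0, so the factor is 0 at a massless point and 1 otherwise. *)
by have [->|C0] := eqVneq (atom (b k)) 0; rewrite ?mul0r// divff.
Qed.

(** The integral of the density [H] over [x]; it is 1 at every point that [c] charges. *)
Let G (y : borel E) : R := \sum_(k < n) (y == b k)%:R * (w k / atom (b k)).

Let integral_mu_H y : (\int[mu]_x (H x y)%:E = (G y)%:E)%E.
Proof.
under eq_integral do rewrite -sumEFin.
rewrite ge0_integral_sum//; last 2 first.
- by move=> k; apply/measurable_EFinP; apply: measurable_funM => //; exact: measurable_funM.
- by move=> k x _; rewrite lee_fin mulr_ge0// divr_ge0.
rewrite -sumEFin; apply: eq_bigr => k _.
under eq_integral do rewrite mulrC -mulrA EFinM.
rewrite ge0_integralZr//; last 3 first.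
- exact/measurable_EFinP.
- by move=> x _; rewrite lee_fin.
- by rewrite lee_fin mulr_ge0// invr_ge0.
by rewrite hw -EFinM; congr EFin; ring.
Qed.

Let measurable_G : measurable_fun setT G.
Proof. by apply: measurable_sum => k; exact: measurable_funM. Qed.

Let G_ge0 y : 0 <= G y.
Proof. by apply: sumr_ge0 => k _; rewrite mulr_ge0// divr_ge0. Qed.

(** The terms with [b j = b k] sum to [atom (b k) / atom (b k)], and this mass is positive since it
    includes [w k]. *)
Let G_atom k : (k < n)%N -> w k != 0 -> G (b k) = 1.
Proof.
move=> kn wk.
have C0 : atom (b k) != 0.
  rewrite gt_eqF// /atom (bigD1 (Ordinal kn))//= eqxx mulr1 ltr_pwDl//.
    by rewrite lt_neqAle eq_sym wk w0.
  by apply: sumr_ge0 => j _; rewrite mulr_ge0.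
rewrite -(divff C0) {2}/atom mulr_suml; apply: eq_bigr => j _.
by have [->|] := eqVneq (b k) (b j); rewrite ?mul0r ?mulr0 ?mul1r ?mulr1 ?mul0r.
Qed.

(** Integrating out [x] first leaves the factor [G z.1], which is 1 almost everywhere for [theta],
    whose first marginal is [c]. *)
Let integral_H_snd (f : borel (E * E)%type -> \bar R) :
  measurable_fun setT f -> (forall z, 0 <= f z)%E ->
  (\int[mu \x theta]_t (f t.2 * (H' t)%:E) = \int[theta]_z f z)%E.
Proof.
move=> mf f0.
have mfH : measurable_fun [set: borel E * borel (E * E)%type]
    (fun t => f t.2 * (H' t)%:E)%E.
  apply: emeasurable_funM; first exact: measurableT_comp mf measurable_snd.
  exact/measurable_EFinP.
have mHl (y : borel E) : measurable_fun setT (fun x => H x y).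
  by apply: measurable_sum => k; apply: measurable_funM => //; exact: measurable_funM.
rewrite fubini_tonelli2//; last by move=> t; rewrite mule_ge0 ?lee_fin.
transitivity (\int[theta]_z (f z * (G z.1)%:E))%E.
  apply: eq_integral => z _; rewrite /fubini_G/= ge0_integralZl//.
  - by rewrite integral_mu_H.
  - by apply/measurable_EFinP; exact: (mHl z.1).
  - by move=> x _; rewrite lee_fin.
have mG1 : measurable_fun [set: borel (E * E)%type] (fun z => G z.1).
  exact: (measurableT_comp measurable_G measurable_borel_fst).
apply: ge0_ae_eq_integral => //.
- by apply: emeasurable_funM => //; exact/measurable_EFinP.
- by move=> z _; rewrite mule_ge0 ?lee_fin.
pose N := [set y : borel E | G y != 1].
have mN : measurable N.
  rewrite (_ : N = setT `&` G @^-1` (~` [set 1])).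
    by apply: measurable_G => //; exact: measurableC.
  by rewrite setTI; apply/seteqP; split => y /= /eqP.
exists (fst @^-1` N); split.
- by rewrite -[X in measurable X]setTI; exact: measurable_borel_fst.
- transitivity (c N); first exact: (ctheta mN).1.
  rewrite cE//; apply: big1 => k _.
  have [->|wk] := eqVneq (w k) 0; first by rewrite mul0e.
  by rewrite diracE memNset ?mule0// /N/= G_atom ?eqxx.
- by move=> z /= zN; apply/eqP => Gz; apply: zN => _; rewrite Gz mule1.
Qed.

Let rhoE (A : set (borel (E * E)%type)) : measurable A ->
  rho A = (\int[mu \x theta]_t ((\1_A (psi t))%:E * (H' t)%:E))%E.
Proof.
move=> mA; transitivity (\int[rho]_z (\1_A z)%:E)%E.
  by rewrite integral_indic// setIT.
rewrite integral_rho//.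
by apply/measurable_EFinP; exact: measurable_indic.
Qed.

Let rho_snd (A : set (borel E)) : measurable A -> rho (snd @^-1` A) = nu A.
Proof.
move=> mA.
have mA2 : measurable (snd @^-1` A : set (borel (E * E)%type)).
  by rewrite -[X in measurable X]setTI; exact: measurable_borel_snd.
transitivity (theta (snd @^-1` A)); last exact: (ctheta mA).2.
rewrite rhoE//.
transitivity (\int[theta]_z (\1_(snd @^-1` A : set (borel (E * E)%type)) z)%:E)%E.
  rewrite -integral_H_snd//.
  by apply/measurable_EFinP; exact: measurable_indic.
by rewrite integral_indic// setIT.
Qed.

Let rho_fst_le (A : set (borel E)) : measurable A ->
  (rho (fst @^-1` A) <= mu A)%E.
Proof.
move=> mA.
have mA1 : measurable (fst @^-1` A : set (borel (E * E)%type)).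
  by rewrite -[X in measurable X]setTI; exact: measurable_borel_fst.
rewrite rhoE//.
apply: (le_trans (integral_H_le (f := fun x _ => \1_A x) _ _)) => //.
  have m1A : measurable_fun setT (\1_A : borel E -> R).
    exact: measurable_indic.
  exact: (measurableT_comp m1A measurable_fst).
rewrite (eq_integral (fun x => (\1_A x)%:E)); last first.
  by move=> x _; rewrite -mulr_suml h1 mul1r.
by rewrite integral_indic// setIT.
Qed.

Let rhoT : rho setT = 1%E.
Proof. by rewrite -(preimage_setT snd) rho_snd// probability_setT. Qed.

(** Both measures have total mass one and [rho_fst_le] holds for [A] and for its complement, so a
    strict inequality on [A] is impossible. *)
Let rho_fst (A : set (borel E)) : measurable A -> rho (fst @^-1` A) = mu A.
Proof.
move=> mA; apply/eqP; rewrite eq_le rho_fst_le//= leNgt; apply/negP => lt.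
have mA1 : measurable (fst @^-1` A : set (borel (E * E)%type)).
  by rewrite -[X in measurable X]setTI; exact: measurable_borel_fst.
have : (rho setT < mu setT)%E.
  rewrite -(setUv A) -(setUv (fst @^-1` A)).
  rewrite !measureU//; last 4 first.
  - exact: measurableC.
  - exact: setICr.
  - exact: measurableC.
  - exact: setICr.
  have mCA := measurableC mA.
  rewrite lte_leD// ?(rho_fst_le mCA)//.
  by rewrite ge0_fin_numE ?(le_lt_trans (rho_fst_le mCA))// ltey_eq fin_num_measure.
by rewrite rhoT probability_setT ltxx.
Qed.

(** The path from [x] to [z] is split at [y] under the reweighted [mu \x theta]; [integral_H_le]
    bounds the first leg and [integral_H_snd] identifies the second with the cost of [theta]. *)
Lemma glue_coupling (p : R) : 0 <= p ->
  exists2 r : probability (borel (E * E)%type) R, coupling mu nu r &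
    (\int[r]_z (mdist z.1 z.2 `^ p)%:E <= (2 `^ p)%:E *
      (\int[mu]_x (\sum_(k < n) h k x * mdist (x : E) (b k) `^ p)%:E +
       \int[theta]_z (mdist z.1 z.2 `^ p)%:E))%E.
Proof.
move=> p0.
exists (mprob rhoT).
  by move=> A mA; split; [exact: rho_fst|exact: rho_snd].
pose dp (z : borel (E * E)%type) := mdist z.1 z.2 `^ p.
have dp0 z : 0 <= dp z by exact: powR_ge0.
have mdp : measurable_fun setT dp.
  exact: (measurableT_comp (measurable_powR p) measurable_mdist_prod).
have mdpE : measurable_fun setT (EFin \o dp) by exact/measurable_EFinP.
have mdp2 : measurable_fun [set: borel E * borel E] (fun t => dp (t.1, t.2)).
  have := measurableT_comp mdp (measurable_borel_prod sE).
  by congr measurable_fun; apply/funext => -[].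
have mdxy : measurable_fun [set: borel E * borel (E * E)%type]
    (fun t => dp (t.1, t.2.1)).
  have mg : measurable_fun [set: borel E * borel (E * E)%type]
      (fun t => (t.1, t.2.1) : borel E * borel E).
    apply: measurable_fun_pair => //.
    by apply: (measurableT_comp measurable_borel_fst); exact: measurable_snd.
  exact: (measurableT_comp mdp2 mg).
have mdyz : measurable_fun [set: borel E * borel (E * E)%type]
    (fun t => dp t.2) by exact: (measurableT_comp mdp measurable_snd).
rewrite (_ : \int[mprob rhoT]_z _ = \int[rho]_z (EFin \o dp) z)%E// integral_rho//.
apply: (@le_trans _ _ (\int[mu \x theta]_t ((2 `^ p)%:E *
    ((dp (t.1, t.2.1))%:E * (H' t)%:E + (dp t.2)%:E * (H' t)%:E)))%E).
  apply: ge0_le_integral => //.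
  - by move=> t _; rewrite mule_ge0 ?lee_fin.
  - apply: emeasurable_funM; last exact/measurable_EFinP.
    exact: (measurableT_comp mdpE measurable_psi).
  - apply: measurable_funeM; apply: emeasurable_funD; apply: emeasurable_funM;
      exact/measurable_EFinP.
  move=> t _; rewrite (_ : (2 `^ p)%:E * _ =
    (2 `^ p * (dp (t.1, t.2.1) + dp t.2) * H' t)%:E)%E; last first.
    by rewrite -mulrA mulrDl EFinM EFinD !EFinM.
  rewrite -EFinM lee_fin ler_wpM2r//.
  apply: (le_trans _ (ler_powRD p0 (mdist_ge0 _ _) (mdist_ge0 _ _))).
  by rewrite ge0_ler_powR ?nnegrE ?addr_ge0 ?mdist_ge0// metric_triangle.
rewrite ge0_integralZl//; last 2 first.
- by apply: emeasurable_funD; apply: emeasurable_funM; exact/measurable_EFinP.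
- by move=> t _; rewrite adde_ge0 ?mule_ge0 ?lee_fin.
rewrite lee_wpmul2l ?lee_fin ?powR_ge0//.
rewrite ge0_integralD//; last 4 first.
- by move=> t _; rewrite mule_ge0 ?lee_fin.
- by apply: emeasurable_funM; exact/measurable_EFinP.
- by move=> t _; rewrite mule_ge0 ?lee_fin.
- by apply: emeasurable_funM; exact/measurable_EFinP.
rewrite leeD//.
  exact: (integral_H_le (f := fun x y => dp (x, y))).
by rewrite (integral_H_snd (f := EFin \o dp))// => z; rewrite lee_fin.
Qed.

End glue.

(** * Wasserstein estimates through a finitely supported measure *)

Section wasserstein_bounds.
Context {R : realType} {E : completeMetricType R}.
Hypothesis sE : separable E.
Variable p : R.
Hypothesis p1 : 1 <= p.
Implicit Types mu nu c : probability (borel E) R.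
Implicit Types theta : probability (borel (E * E)%type) R.

Let p0 : 0 < p. Proof. exact: lt_le_trans p1. Qed.

Let cost theta : \bar R := (\int[theta]_z (mdist z.1 z.2 `^ p)%:E)%E.

Let cost_ge0 theta : (0 <= cost theta)%E.
Proof. by apply: integral_ge0 => z _; rewrite lee_fin powR_ge0. Qed.

Let measurable_cost :
  measurable_fun [set: borel (E * E)%type]
    (fun z => (mdist z.1 z.2 `^ p)%:E : \bar R).
Proof.
apply/measurable_EFinP.
exact: (measurableT_comp (measurable_powR p) measurable_mdist_prod).
Qed.

(** Removes the root from the definition of the distance, so that costs are compared directly. *)
Let poweR_lt (x : \bar R) (e : R) : 0 < e -> (0 <= x)%E ->
  (x `^ p^-1 < e%:E)%E = (x < (e `^ p)%:E)%E.
Proof.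
move=> e0; case: x => [r|_|//]; last by rewrite poweRyr ?invr_eq0 ?gt_eqF.
rewrite lee_fin => r0; rewrite poweR_EFin !lte_fin.
have {1}-> : e = (e `^ p) `^ p^-1 by rewrite -powRrM divff ?gt_eqF// powRr1// ltW.
apply/idP/idP; last by apply: gt0_ltr_powR; rewrite ?invr_gt0// nnegrE// powR_ge0.
apply: contraTT; rewrite -!leNgt => ?.
by apply: ge0_ler_powR; rewrite ?invr_ge0 ?nnegrE ?powR_ge0// ltW.
Qed.

Lemma coupling_wasserstein_lt mu nu theta (e : R) : 0 < e ->
  coupling mu nu theta ->
  (\int[theta]_z (mdist z.1 z.2 `^ p)%:E < (e `^ p)%:E)%E ->
  (wasserstein_dist p mu nu < e%:E)%E.
Proof.
move=> e0 ct; rewrite -poweR_lt//; last exact: cost_ge0.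
by apply: le_lt_trans; apply: ereal_inf_lbound; exists theta.
Qed.

Lemma wasserstein_lt_coupling mu nu (e : R) : 0 < e ->
  (wasserstein_dist p mu nu < e%:E)%E ->
  exists2 theta, coupling mu nu theta &
    (\int[theta]_z (mdist z.1 z.2 `^ p)%:E < (e `^ p)%:E)%E.
Proof.
move=> e0 /ereal_inf_lt[_ [theta ct <-]]; rewrite poweR_lt//; last exact: cost_ge0.
by exists theta.
Qed.

(** Takes the image of [c] under the diagonal map, on which the distance vanishes. *)
Let coupling_diag c : exists2 theta, coupling c c theta & cost theta = 0%E.
Proof.
pose f (x : borel E) : borel (E * E)%type := (x, x).
have mf : measurable_fun setT f.
  apply: measurable_g_sigma_algebra; apply/continuousP => x.
  by apply: cvg_pair; exact: cvg_id.
pose fm : {mfun borel E >-> borel (E * E)%type} :=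
  HB.pack f (isMeasurableFun.Build _ _ _ _ _ mf).
exists (distribution c fm) => //.
rewrite /cost ge0_integral_distribution//=; last first.
  by move=> z; rewrite lee_fin powR_ge0.
by apply: integral0_eq => x _; rewrite /= mdistxx powR0// gt_eqF.
Qed.

(** Takes the image under the exchange of coordinates, which preserves the symmetric cost. *)
Let coupling_swap mu nu theta : coupling mu nu theta ->
  exists2 theta', coupling nu mu theta' & cost theta' = cost theta.
Proof.
move=> ct.
pose f (z : borel (E * E)%type) : borel (E * E)%type := (z.2, z.1).
have mf : measurable_fun setT f.
  apply: measurable_g_sigma_algebra; apply/continuousP => x.
  by apply: cvg_pair; [exact: cvg_snd|exact: cvg_fst].
pose fm : {mfun borel (E * E)%type >-> borel (E * E)%type} :=
  HB.pack f (isMeasurableFun.Build _ _ _ _ _ mf).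
exists (distribution theta fm).
  by move=> A mA; have [] := ct _ mA.
rewrite /cost ge0_integral_distribution//=; last first.
  by move=> z; rewrite lee_fin powR_ge0.
by apply: eq_integral => z _; rewrite /= metric_sym.
Qed.

Section finite_support.
Variables (mu c : probability (borel E) R).
Variables (n : nat) (b : nat -> E) (w : nat -> R) (h : nat -> borel E -> R).
Hypothesis w0 : forall k, 0 <= w k.
Hypothesis cE : forall A : set (borel E), measurable A ->
  (c A = \sum_(k < n) (w k)%:E * \d_(b k : borel E) A)%E.
Hypothesis mh : forall k, measurable_fun [set: borel E] (h k).
Hypothesis h0 : forall k x, 0 <= h k x.
Hypothesis h1 : forall x, \sum_(k < n) h k x = 1.
Hypothesis hw : forall k, (\int[mu]_x (h k x)%:E = (w k)%:E)%E.
Variable e : R.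
Hypothesis e0 : 0 < e.
Hypothesis he : (\int[mu]_x (\sum_(k < n) h k x * mdist (x : E) (b k) `^ p)%:E <
  ((e / 2) `^ p)%:E)%E.

Let powR2 (x : R) : 0 <= x -> 2 `^ p * x `^ p = (2 * x) `^ p.
Proof. by move=> x0; rewrite powRM. Qed.

(** The gluing is applied to the diagonal coupling of [c], which costs nothing; its constant is
    absorbed by the [e / 2] in [he], and a swap restores the order of the arguments. *)
Lemma finite_support_wasserstein_lt : (wasserstein_dist p c mu < e%:E)%E.
Proof.
have [theta ct theta0] := coupling_diag c.
have [r cr] := glue_coupling sE ct w0 cE mh h0 h1 hw (ltW p0).
rewrite [X in (_ + X)%E]theta0 adde0 => rle.
have [r' cr' r'E] := coupling_swap cr.
apply: (coupling_wasserstein_lt e0 cr').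
rewrite [ltLHS]r'E; apply: (le_lt_trans rle).
have -> : e `^ p = 2 `^ p * (e / 2) `^ p.
  by rewrite powR2 ?divr_ge0 ?(ltW e0)//; congr (_ `^ _); field.
by rewrite EFinM lte_pmul2l// lte_fin powR_gt0.
Qed.

Lemma finite_support_wasserstein_triangle nu :
  (wasserstein_dist p c nu < e%:E)%E ->
  (wasserstein_dist p mu nu < (4 * e)%:E)%E.
Proof.
move=> /(wasserstein_lt_coupling e0)[theta ct te].
have [r cr rle] := glue_coupling sE ct w0 cE mh h0 h1 hw (ltW p0).
apply: (coupling_wasserstein_lt _ cr); first by rewrite mulr_gt0.
apply: (le_lt_trans rle).
(* One factor 2 absorbs the constant of the gluing; the other covers the sum of two costs below the
   [p]-th power of [e], as 2 is at most its own [p]-th power. *)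
have -> : 4 * e = 2 * (2 * e) by ring.
rewrite -powR2 ?mulr_ge0 ?(ltW e0)// EFinM lte_pmul2l ?lte_fin ?powR_gt0//.
apply: (@lt_le_trans _ _ ((e `^ p)%:E + (e `^ p)%:E)%E).
  apply: lteD te; apply: (lt_le_trans he); rewrite lee_fin ge0_ler_powR//.
  - exact: ltW.
  - by rewrite nnegrE divr_ge0 ?(ltW e0).
  - by rewrite nnegrE ltW.
  - by rewrite ler_pdivrMr// ler_peMr ?(ltW e0)// ler1n.
rewrite -EFinD lee_fin -mulr2n -[leLHS]mulr_natl -powR2 ?(ltW e0)//.
by rewrite ler_wpM2r ?powR_ge0// le1r_powR// ler1n.
Qed.

End finite_support.

End wasserstein_bounds.

(** * Projection to the closest of finitely many points *)

Section nearest.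
Context {R : realType} {E : completeMetricType R}.
Variable a : nat -> E.

(* The index of a closest point to [x] among [a 0, ..., a n]. *)
Fixpoint nearest n (x : borel E) : nat :=
  if n is m.+1 then
    if mdist (x : E) (a n) < mdist (x : E) (a (nearest m x)) then n
    else nearest m x
  else 0%N.

Lemma nearest_le n x : (nearest n x <= n)%N.
Proof. by elim: n => //= n IH; case: ifPn => // _; exact: leqW. Qed.

Lemma nearest_mdist_le k n x : (k <= n)%N ->
  mdist (x : E) (a (nearest n x)) <= mdist (x : E) (a k).
Proof.
elim: n => [|n IH]; first by rewrite leqn0 => /eqP ->.
rewrite leq_eqVlt ltnS => /predU1P[->|kn] /=; case: ifPn => //.
  by rewrite -leNgt.
by move/ltW/le_trans; apply; exact: IH.
by move=> _; exact: IH.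
Qed.

(** Proved together because the test that defines the next index involves the distance attained by
    the previous one. *)
Let measurable_nearest_mdist n : measurable_fun setT (nearest n) /\
  measurable_fun setT (fun x : borel E => mdist (x : E) (a (nearest n x)) : R).
Proof.
elim: n => [|n [IH1 IH2]] /=.
  by split; [exact: measurable_cst|exact: measurable_mdist].
have mlt : measurable_fun [set: borel E]
    (fun x : borel E => mdist (x : E) (a n.+1) < mdist (x : E) (a (nearest n x))).
  by apply: measurable_fun_ltr => //; exact: measurable_mdist.
split; first by apply: measurable_fun_ifT => //; exact: measurable_cst.
rewrite (_ : (fun _ => _) = (fun x : borel E =>
    if mdist (x : E) (a n.+1) < mdist (x : E) (a (nearest n x))
    then mdist (x : E) (a n.+1) else mdist (x : E) (a (nearest n x)))).
  by apply: measurable_fun_ifT => //; exact: measurable_mdist.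
by apply/funext => x; case: ifPn.
Qed.

Lemma measurable_nearest n : measurable_fun setT (nearest n).
Proof. by have [] := measurable_nearest_mdist n. Qed.

Lemma nearest_mdist_cvg x : dense_seq a ->
  mdist (x : E) (a (nearest n x)) @[n --> \oo] --> (0 : R).
Proof.
move=> da; apply/cvgrPdist_lt => e e0.
have [k xk] := da x _ e0; exists k => // n /= kn.
rewrite sub0r normrN ger0_norm ?mdist_ge0//.
exact: (le_lt_trans (nearest_mdist_le x kn)).
Qed.

Variable p : R.
Hypothesis p1 : 1 <= p.

Let p0 : 0 < p. Proof. exact: lt_le_trans p1. Qed.

(** A bound for the cost of transporting [x]: the first term is for the move to the closest point,
    the second for the fraction, at most [n.+1%:R^-1], that is sent to [a 0]. *)
Definition nearest_error n (x : borel E) : R :=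
  mdist (x : E) (a (nearest n x)) `^ p + n.+1%:R^-1 * mdist (x : E) (a 0%N) `^ p.

Lemma nearest_error_ge0 n x : 0 <= nearest_error n x.
Proof. by rewrite addr_ge0 ?mulr_ge0 ?powR_ge0 ?invr_ge0. Qed.

Lemma measurable_nearest_error n : measurable_fun setT (nearest_error n).
Proof.
apply: measurable_funD.
  apply: (measurableT_comp (measurable_powR p)).
  by have [] := measurable_nearest_mdist n.
apply: measurable_funM => //; apply: (measurableT_comp (measurable_powR p)).
exact: measurable_mdist.
Qed.

Let measurable_mdist_a0 : measurable_fun [set: borel E]
  (fun x : borel E => mdist (x : E) (a 0%N) `^ p).
Proof. exact: (measurableT_comp (measurable_powR p) (measurable_mdist _)). Qed.

(** To move the base point from [y0] to [y], the quasi-triangle inequality adds only a constant,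
    which is integrable for a probability. *)
Lemma finite_moment_lty (mu : probability (borel E) R) (y : E) :
  finite_moment p mu -> (\int[mu]_x (mdist (x : E) y `^ p)%:E < +oo)%E.
Proof.
move=> [y0 iy0].
have mpow z : measurable_fun [set: borel E] (fun x : borel E => mdist (x : E) z `^ p).
  exact: (measurableT_comp (measurable_powR p) (measurable_mdist _)).
apply: (@le_lt_trans _ _ (\int[mu]_x ((2 `^ p)%:E *
    ((mdist (x : E) y0 `^ p)%:E + (mdist y0 y `^ p)%:E))))%E.
  apply: ge0_le_integral => //.
  - by move=> x _; rewrite lee_fin powR_ge0.
  - exact/measurable_EFinP.
  - apply: measurable_funeM; apply: emeasurable_funD => //.
    exact/measurable_EFinP.
  move=> x _; rewrite -EFinD -EFinM lee_fin.
  apply: (le_trans _ (ler_powRD (ltW p0) (mdist_ge0 _ _) (mdist_ge0 _ _))).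
  by rewrite ge0_ler_powR ?nnegrE ?addr_ge0 ?mdist_ge0 ?(ltW p0)// metric_triangle.
have mpow0 : measurable_fun [set: borel E] (fun x : borel E => (mdist (x : E) y0 `^ p)%:E).
  exact/measurable_EFinP.
rewrite ge0_integralZl//; last 2 first.
- by apply: emeasurable_funD.
- by move=> x _; rewrite -EFinD lee_fin addr_ge0 ?powR_ge0.
rewrite ge0_integralD//; last 2 first.
- by move=> x _; rewrite lee_fin powR_ge0.
- by move=> x _; rewrite lee_fin powR_ge0.
rewrite integral_cst// [X in (_ + _ * X)%E](@probability_setT _ _ _ mu) mule1.
rewrite lte_mul_pinfty ?lee_fin ?powR_ge0//.
by rewrite lte_add_pinfty ?ltry.
Qed.

Lemma nearest_error_cvg (mu : probability (borel E) R) : dense_seq a ->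
  finite_moment p mu ->
  (\int[mu]_x (nearest_error n x)%:E @[n --> \oo] --> 0)%E.
Proof.
move=> da fmu.
rewrite -[X in _ --> X](@integral0 _ (borel E) R mu setT).
(* Since [a 0] is always among the candidates, each of the two error terms is at most the [p]-th
   power of the distance to [a 0]. *)
apply: (@dominated_cvg _ _ _ mu _ measurableT _ _
    (fun x : borel E => (2 * mdist (x : E) (a 0%N) `^ p)%:E)) => //.
- by move=> n; apply/measurable_EFinP; exact: measurable_nearest_error.
- move=> x _; apply: cvg_EFin; first exact: nearW.
  rewrite /comp/= /nearest_error.
  rewrite (_ : 0 = 0 `^ p + 0 * mdist (x : E) (a 0%N) `^ p :> R); last first.
    by rewrite mul0r addr0 powR0// gt_eqF.
  apply: cvgD; last by apply: cvgMl; exact: cvg_harmonic.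
  rewrite powR0 ?gt_eqF//; apply/cvgrPdist_lt => e e0.
  (* Distances below the [p]-th root of [e] have [p]-th power below [e]. *)
  have e'0 : 0 < e `^ p^-1 by exact: powR_gt0.
  have /cvgrPdist_lt/(_ _ e'0) := nearest_mdist_cvg x da.
  apply: filterS => n; rewrite !sub0r !normrN ger0_norm ?mdist_ge0// => lte'.
  rewrite ger0_norm ?powR_ge0// -[ltRHS](powRr1 (ltW e0)).
  rewrite -(mulVf (lt0r_neq0 p0)) powRrM.
  by apply: gt0_ltr_powR => //; rewrite nnegrE ?mdist_ge0 ?ltW.
- apply/integrableP; split.
    by apply/measurable_EFinP; exact: measurable_funM.
  under eq_integral.
    move=> x _; rewrite gee0_abs ?lee_fin ?mulr_ge0 ?powR_ge0// EFinM; over.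
  rewrite ge0_integralZl//; last by move=> x _; rewrite lee_fin powR_ge0.
    by rewrite lte_mul_pinfty// finite_moment_lty.
  exact/measurable_EFinP.
- move=> n x _; rewrite gee0_abs ?lee_fin ?nearest_error_ge0//.
  rewrite mulr_natl mulr2n lerD//.
    by rewrite ge0_ler_powR ?nnegrE ?mdist_ge0 ?(ltW p0)// nearest_mdist_le.
  by rewrite ler_piMl ?powR_ge0// invf_le1// ler1n.
Qed.

End nearest.

(** * Cells of closest points and weights lowered within them *)

Section cells.
Context {R : realType} {E : completeMetricType R}.
Variable a : nat -> E.

Definition cell_mass (mu : probability (borel E) R) n j : R :=
  fine (mu (nearest a n @^-1` [set j])).

(* The mass missing from the cells is put on [a 0]. *)
Definition weight n (q : nat -> R) k : R :=
  \sum_(j < n.+1) q j * (j == k :> nat)%:R +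
  (k == 0%N)%:R * (1 - \sum_(j < n.+1) q j).

Variables (mu : probability (borel E) R) (n : nat).

Let measurable_cell j : measurable (nearest a n @^-1` [set j]).
Proof.
by rewrite -[X in measurable X]setTI; exact: measurable_nearest.
Qed.

(** Exactly one of the cells contains [x]. *)
Lemma sum_nearest (F : nat -> R) x :
  F (nearest a n x) = \sum_(j < n.+1) F j * \1_(nearest a n @^-1` [set val j]) x.
Proof.
pose i := Ordinal (nearest_le a n x : (nearest a n x < n.+1)%N).
rewrite (bigD1 i)//= indicE mem_set// mulr1 big1 ?addr0// => j ji.
rewrite indicE memNset ?mulr0//= => ij.
by move/eqP: ji; apply; apply: val_inj.
Qed.

Lemma integral_nearest (F : nat -> R) : (forall j, 0 <= F j) ->
  (\int[mu]_x (F (nearest a n x))%:E =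
   (\sum_(j < n.+1) F j * cell_mass mu n j)%:E)%E.
Proof.
move=> F0; under eq_integral do rewrite sum_nearest -sumEFin.
have m1 j : measurable_fun [set: borel E]
    (fun x => (\1_(nearest a n @^-1` [set j]) x)%:E : \bar R).
  by apply/measurable_EFinP; apply: measurable_indic; exact: measurable_cell.
rewrite ge0_integral_sum//; last 2 first.
- move=> j; under eq_fun do rewrite EFinM.
  by apply: measurable_funeM; exact: m1.
- by move=> j x _; rewrite lee_fin mulr_ge0.
rewrite -sumEFin; apply: eq_bigr => j _.
under eq_integral do rewrite EFinM.
rewrite ge0_integralZl ?lee_fin//.
rewrite integral_indic ?setIT ?EFinM ?fineK ?fin_num_measure//.
Qed.

Lemma sum_cell_mass : \sum_(j < n.+1) cell_mass mu n j = 1.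
Proof.
apply: EFin_inj; under eq_bigr do rewrite -[cell_mass _ _ _]mul1r.
rewrite -(integral_nearest (F := fun=> 1))// integral_cst// mul1e.
exact: probability_setT.
Qed.

Variable q : nat -> R.
Hypothesis hq : forall k,
  (1 - n.+1%:R^-1) * cell_mass mu n k <= q k <= cell_mass mu n k.

Let u0 k : 0 <= cell_mass mu n k. Proof. exact: fine_ge0. Qed.

Let c0 : 0 <= 1 - n.+1%:R^-1 :> R.
Proof. by rewrite subr_ge0 invf_le1// ler1n. Qed.

Let q0 k : 0 <= q k.
Proof. by have /andP[+ _] := hq k; apply: le_trans; rewrite mulr_ge0. Qed.

(** The missing mass is nonnegative because each [q j] is at most the mass of its cell and these
    masses sum to one. *)
Lemma weight_ge0 k : 0 <= weight n q k.
Proof.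
rewrite addr_ge0 ?sumr_ge0//; first by move=> j _; rewrite mulr_ge0.
rewrite mulr_ge0// subr_ge0 -sum_cell_mass; apply: ler_sum => j _.
by have /andP[] := hq j.
Qed.

Lemma sum_weight : \sum_(k < n.+1) weight n q k = 1.
Proof.
rewrite big_split/= exchange_big/=.
rewrite (eq_bigr (fun j : 'I_n.+1 => q j)); last first.
  move=> j _; rewrite (bigD1 j)//= eqxx mulr1 big1 ?addr0// => k kj.
  by rewrite eq_sym (negbTE (_ : val k != val j))// mulr0.
rewrite -mulr_suml [X in _ + X * _](_ : _ = 1) ?mul1r ?subrKC//.
rewrite (bigD1 ord0)//= big1 ?addr0// => k k0.
by rewrite (negbTE (_ : val k != 0%N)).
Qed.

(** The fraction of the mass of cell [k] that [q] retains; the value 1 on a null cell keeps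
    [r_bounds] true there. *)
Let r k := if cell_mass mu n k == 0 then 1 else q k / cell_mass mu n k.

Let rE k : r k * cell_mass mu n k = q k.
Proof.
rewrite /r; case: ifPn => [/eqP uk|uk]; last by rewrite divfK.
(* On a null cell both bounds in [hq] are 0, so [q k] is 0. *)
by have := hq k; rewrite uk !mulr0 -eq_le => /eqP.
Qed.

Let r_bounds k : 1 - n.+1%:R^-1 <= r k <= 1.
Proof.
rewrite /r; case: ifPn => [_|uk]; first by rewrite lexx gerBl invr_ge0 ler0n.
have ugt0 : 0 < cell_mass mu n k by rewrite lt_neqAle eq_sym uk u0.
by rewrite ler_pdivlMr// ler_pdivrMr// mul1r.
Qed.

Let r_ge0 k : 0 <= r k.
Proof. by have /andP[+ _] := r_bounds k; exact: le_trans. Qed.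

Let r_le1 k : 0 <= 1 - r k.
Proof. by rewrite subr_ge0; have /andP[] := r_bounds k. Qed.

(* Row [j] of this stochastic matrix splits the cell [j] between the points
   [a j] and [a 0]. *)
Let alpha k j : R := r j * (j == k)%:R + (k == 0%N)%:R * (1 - r j).

Let alpha_ge0 k j : 0 <= alpha k j.
Proof. by rewrite addr_ge0 ?mulr_ge0. Qed.

Let sum_alpha (D : nat -> R) j : (j < n.+1)%N ->
  \sum_(k < n.+1) alpha k j * D k = r j * D j + (1 - r j) * D 0%N.
Proof.
move=> jn; under eq_bigr do rewrite mulrDl.
rewrite big_split/=; congr (_ + _).
  rewrite (bigD1 (Ordinal jn))//= eqxx mulr1 big1 ?addr0// => k kj.
  rewrite [j == _](_ : _ = false) ?mulr0 ?mul0r//.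
  by apply/negbTE; rewrite eq_sym; exact: kj.
rewrite (bigD1 ord0)//= mul1r big1 ?addr0// => k k0.
by rewrite (negbTE (_ : val k != 0%N))// !mul0r.
Qed.

(** Supplies the data for the gluing: [h k x] is the fraction of the mass at [x] that is sent to
    [a k], read off from [alpha] at the closest index. *)
Lemma cells_partition p : exists h : nat -> borel E -> R,
  [/\ forall k, measurable_fun setT (h k),
      forall k x, 0 <= h k x,
      forall x, \sum_(k < n.+1) h k x = 1,
      forall k, (\int[mu]_x (h k x)%:E = (weight n q k)%:E)%E &
      forall x, \sum_(k < n.+1) h k x * mdist (x : E) (a k) `^ p <=
        nearest_error a p n x].
Proof.
exists (fun k x => alpha k (nearest a n x)); split.
- move=> k; apply: (measurableT_comp _ (measurable_nearest a n)).
  (* Every set of naturals is measurable, so any function of the index is. *)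
  by move=> _ A _.
- by move=> k x; exact: alpha_ge0.
- move=> x; have := sum_alpha (fun=> 1) (nearest_le a n x : (_ < n.+1)%N).
  by under eq_bigr do rewrite mulr1; move=> ->; rewrite !mulr1 subrKC.
- move=> k; rewrite integral_nearest//; congr EFin.
  under eq_bigr do rewrite /alpha mulrDl mulrAC rE -mulrA mulrBl mul1r rE.
  rewrite big_split/= -mulr_sumr; congr (_ + _ * _).
  by rewrite sumrB sum_cell_mass.
- move=> x; rewrite (sum_alpha (fun k => mdist (x : E) (a k) `^ p) (nearest_le a n x : (_ < n.+1)%N)).
  have /andP[r1 r2] := r_bounds (nearest a n x).
  rewrite lerD ?ler_piMl ?powR_ge0// ler_wpM2r ?powR_ge0//.
  by rewrite lerBlDl -lerBlDr.
Qed.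

End cells.

(** * Discrete measures and rational weights *)

Lemma finite_support_wasserstein_space (R : realType) (E : completeMetricType R)
    (p : R) n (w : nat -> R) (b : nat -> E) :
  (forall k, 0 <= w k) -> \sum_(k < n) w k = 1 ->
  exists c : wasserstein_space E p, forall A : set (borel E), measurable A ->
    (c A = \sum_(k < n) (w k)%:E * \d_(b k : borel E) A)%E.
Proof.
move=> w0 w1; pose w' k : {nonneg R} := NngNum (w0 k).
pose m := msum (fun k => mscale (w' k) \d_(b k : borel E)) n.
have m1 : m setT = 1%E.
  rewrite /m /msum/= -w1 -sumEFin; apply: eq_bigr => k _.
  by rewrite /mscale/= diracT mule1.
have mE A : measurable A ->
    mprob m1 A = (\sum_(k < n) (w k)%:E * \d_(b k : borel E) A)%E by [].
suff fm : finite_moment p (mprob m1) by exists (WassersteinSpace fm).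
(* The moment about any point is a finite sum of reals, so [b 0] will do. *)
exists (b 0%N); rewrite (ge0_integral_sum_dirac w0 mE).
- by under eq_bigr do rewrite -EFinM; rewrite sumEFin ltry.
- exact: measurable_mdist_powR.
- by move=> x; rewrite lee_fin powR_ge0.
Qed.

(** Rational weights keep the family of discrete measures countable; a null cell receives weight
    0. *)
Lemma exists_rat_weight (R : realType) (u d : R) : 0 < d -> 0 <= u ->
  exists q : rat, (1 - d) * u <= ratr q <= u.
Proof.
move=> d0; rewrite le_eqVlt => /predU1P[<-|u0].
  by exists 0; rewrite mulr0 raddf0 lexx.
have [q] : exists q : rat, ratr q \in `](1 - d) * u, u[.
  by apply: rat_in_itvoo; rewrite mulrBl mul1r gtrBl mulr_gt0.
by rewrite in_itv/= => /andP[? ?]; exists q; rewrite !ltW.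
Qed.

(** * Measurability in [t] of the approximation conditions *)

Section certificate.
Context {dI dO} {I : measurableType dI} {Omega : measurableType dO}.
Context {R : realType} {E : completeMetricType R}.
Variables (P : probability Omega R) (X : {mfun (I * Omega)%type >-> borel E}).

Let measurable_X : measurable_fun [set: I * Omega] X.
Proof. exact: measurable_funPT. Qed.

(** The law at [t] gives [A] the probability of the [t]-section of the preimage of [A] under [X],
    which is measurable in [t]. *)
Lemma measurable_law (A : set (borel E)) : measurable A ->
  measurable_fun setT (fun t => law P X t A).
Proof.
move=> mA; have -> : (fun t => law P X t A) = P \o xsection (X @^-1` A).
  apply/funext => t; congr (P _).
  by apply/seteqP; split => w; rewrite /xsection/= inE.
apply: measurable_fun_xsection.
by rewrite -[X in measurable X]setTI; exact: measurable_X.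
Qed.

(** After a change of variables this is an inner Fubini-Tonelli integral of [f \o X]. *)
Lemma measurable_integral_law (f : borel E -> \bar R) : measurable_fun setT f ->
  (forall x, 0 <= f x)%E -> measurable_fun setT (fun t => \int[law P X t]_x f x)%E.
Proof.
move=> mf f0.
under eq_fun do rewrite ge0_integral_distribution//.
apply: (measurable_fun_fubini_tonelli_F (m2 := P) (f \o X)).
  exact: measurableT_comp mf measurable_X.
by move=> t; exact: f0.
Qed.

Variables (a : nat -> E) (p : R).

(* Sufficient, measurable in [t], for the discrete measure with weights
   [weight n (ratr \o nth 0 s)] at the points [a k] to be close to the law of
   [X t]. *)
Definition certificate n (s : seq rat) (e : R) : set I :=
  [set t | (forall k, (1 - n.+1%:R^-1) * cell_mass a (law P X t) n k <=
      ratr (nth 0 s k) <= cell_mass a (law P X t) n k) /\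
    (\int[law P X t]_x (nearest_error a p n x)%:E < e%:E)%E].

(** There are countably many conditions, each comparing functions that are measurable in [t]. *)
Lemma measurable_certificate n s e : measurable (certificate n s e).
Proof.
rewrite (_ : certificate n s e = (\bigcap_k
    ([set t | (1 - n.+1%:R^-1) * cell_mass a (law P X t) n k <= ratr (nth 0 s k)]
     `&` [set t | ratr (nth 0 s k) <= cell_mass a (law P X t) n k])) `&`
    [set t | (\int[law P X t]_x (nearest_error a p n x)%:E < e%:E)%E]); last first.
  apply/seteqP; split => [t [tk te]|t [tk te]]; split => // k.
    by move=> _; have /andP[] := tk k.
  by have [/= -> ->] := tk k Logic.I.
have mcm k : measurable_fun setT (fun t => cell_mass a (law P X t) n k).
  apply: (measurableT_comp (@fine_measurable R setT measurableT)).
  apply: measurable_law; rewrite -[X in measurable X]setTI.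
  exact: measurable_nearest.
apply: measurableI.
  apply: bigcapT_measurable => k; apply: measurableI.
    rewrite -[X in measurable X]setTI; apply: measurable_fun_le => //.
    exact: measurable_funM.
  by rewrite -[X in measurable X]setTI; exact: measurable_fun_le.
rewrite -[X in measurable X]setTI; apply: measurable_lte => //.
apply: measurable_integral_law; last by move=> x; rewrite lee_fin nearest_error_ge0.
by apply/measurable_EFinP; exact: measurable_nearest_error.
Qed.

End certificate.

(** * Preimages of open sets under the distribution map *)

Theorem proposition3p14 (R : realType) (p : R) (hp : 1 <= p)
  (E : completeMetricType R) (hE : separable E)
  (L : lmodType R) (i : E -> L) (x0 : E)
  (hstar : star_convex_embedding i x0)
  (hconv : forall (l : R) (x y z : E), 0 <= l <= 1 ->
     i z = (1 - l) *: i x0 + l *: i x ->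
     mdist z y <= (1 - l) * mdist x0 y + l * mdist x y)
  (dI dO : measure_display) (I : measurableType dI) (Omega : measurableType dO)
  (P : probability Omega R)
  (X : {mfun (I * Omega)%type >-> borel E})
  (hX : integrable_process P p X) :
  measurable_fun [set: I] (distribution_map hX).
Proof.
have [a da] := separable_dense_seq hE.
apply: (@measurability _ _ _ (borel_wasserstein E p) _ _ (wasserstein_open E p)) => //.
move=> _ [U oU <-]; rewrite setTI.
pose e m : R := m.+1%:R^-1.
have e0 m : 0 < e m by rewrite invr_gt0.
(* The triple [v = (m, n, s)] codes the radius [e m], the index [n] of the approximation and the
   list [s] of rational weights; such triples are countable. *)
pose cert (v : nat * nat * seq rat) :=
  certificate P X a p v.1.2 v.2 ((e v.1.1 / 2) `^ p).
(* [good v] does not involve [t], so it only selects indices. The measure [c] is prescribed through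
   its values on Borel sets. *)
pose good (v : nat * nat * seq rat) := exists c : wasserstein_space E p,
  (forall A : set (borel E), measurable A -> (c A =
    \sum_(k < v.1.2.+1) (weight v.1.2 (fun j => ratr (nth 0 v.2 j)) k)%:E *
      \d_(a k : borel E) A)%E) /\
  forall nu : wasserstein_space E p,
    (wasserstein_dist p c nu < (e v.1.1)%:E)%E -> U nu.
rewrite (_ : _ @^-1` U = \bigcup_v (if `[< good v >] then cert v else set0)).
  apply: countable_bigcupT_measurable => // v; case: ifPn => // _.
  exact: measurable_certificate.
(* On [cert (m, n, s)] the law lies in the ball of radius [e m] about [c], and that ball lies in the
   ball of radius [4 * e m] about the law. *)
have close t m n s (c : wasserstein_space E p) : cert (m, n, s) t ->
    (forall A : set (borel E), measurable A -> (c A =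
      \sum_(k < n.+1) (weight n (fun j => ratr (nth 0 s j)) k)%:E *
      \d_(a k : borel E) A)%E) ->
    (wasserstein_dist p c (law P X t) < (e m)%:E)%E /\
    forall nu : wasserstein_space E p, (wasserstein_dist p c nu < (e m)%:E)%E ->
      (wasserstein_dist p (law P X t) nu < (4 * e m)%:E)%E.
  move=> [/= hq he] cE; have w0 := weight_ge0 hq.
  have [h [mh h0 h1 hw hle]] := cells_partition hq p.
  have hcost : (\int[law P X t]_x (\sum_(k < n.+1)
      h k x * mdist (x : E) (a k) `^ p)%:E < ((e m / 2) `^ p)%:E)%E.
    apply: le_lt_trans he; apply: ge0_le_integral => //.
    - move=> x _; rewrite lee_fin sumr_ge0// => k _.
      by rewrite mulr_ge0// powR_ge0.
    - apply/measurable_EFinP; apply: measurable_sum => k.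
      apply: measurable_funM => //.
      exact: (measurableT_comp (measurable_powR p) (measurable_mdist _)).
    - by apply/measurable_EFinP; exact: measurable_nearest_error.
    - by move=> x _; rewrite lee_fin.
  split; first exact: (finite_support_wasserstein_lt hE hp w0 cE mh h0 h1 hw).
  move=> nu.
  exact: (finite_support_wasserstein_triangle hE hp w0 cE mh h0 h1 hw).
apply/seteqP; split => [t /oU[r r0 Ur]|t [[[m n] s] _]]; last first.
  (* A good index with a certificate puts the law into a ball contained in [U]. *)
  case: asboolP => // -[c [cE cU]] tc; apply: cU.
  exact: (close t m n s c tc cE).1.
(* With this [m] the ball of radius [e m] about the discrete measure chosen below stays within the
   ball of radius [r] about the law, hence in [U]. *)
have [m mr] : exists m, 4 * e m < r.
  exists (Num.truncn (4 / r)).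
  rewrite /e ltr_pdivrMr// mulrC -ltr_pdivrMr//.
  exact: truncnS_gt.
pose d := (e m / 2) `^ p.
have d0 : 0 < d by apply: powR_gt0; rewrite divr_gt0.
have [n nd] : exists n, (\int[law P X t]_x (nearest_error a p n x)%:E < d%:E)%E.
  have cv := nearest_error_cvg hp da (law_finite_moment hX t).
  have [|n _ /(_ n (leqnn n)) /= nd] := cv [set x | (x < d%:E)%E]; last by exists n.
  by apply: open_nbhs_nbhs; split; [exact: open_ereal_lt_ereal|rewrite /= lte_fin].
have n0 : 0 < n.+1%:R^-1 :> R by rewrite invr_gt0.
have cm0 k : 0 <= cell_mass a (law P X t) n k by exact: fine_ge0.
pose q k := sval (cid (exists_rat_weight n0 (cm0 k))).
pose s := mkseq q n.+1.
have hs k : (1 - n.+1%:R^-1) * cell_mass a (law P X t) n k <=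
    ratr (nth 0 s k) <= cell_mass a (law P X t) n k.
  have [kn|nk] := ltnP k n.+1.
    by rewrite nth_mkseq// /q; case: cid.
  (* Beyond the list the default weight 0 is exact: closest indices never exceed [n], so the cell
     [k] is empty. *)
  rewrite nth_default ?size_mkseq// raddf0 /cell_mass.
  rewrite (_ : nearest a n @^-1` [set k] = set0) ?measure0 ?mulr0 ?lexx//.
  apply/seteqP; split => // x /= xk.
  by have := nearest_le a n x; rewrite xk leqNgt nk.
have ct : cert (m, n, s) t by [].
have [c cE] := finite_support_wasserstein_space p a (weight_ge0 hs) (sum_weight _ _).
exists (m, n, s) => //; case: asboolP => // -[]; exists c; split => //.
move=> nu nuc; apply: Ur.
apply: lt_trans ((close t m n s c ct cE).2 nu nuc) _.
by rewrite lte_fin.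
Qed.
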